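(* For all integers $t,r\ge 2$, the graph $H_{t,r}$ is connected and has \[ n(H_{t,r})=t+2r+2,\qquad m(H_{t,r})=2t+3r+\binom r2,\qquad \Delta(H_{t,r})=t+r, \] \[ \rho(H_{t,r})=1,\qquad \tau_D(H_{t,r})=t+2r+1. \] Moreover, \[ \mu(H_{t,r})=-(t-1)(r-1)<0 . \] Hence every $H_{t,r}$ is a connected graph violating the inequality $\tau_D(G)\le \dfrac{\Delta(\Delta-1)n+2m}{\Delta^2+1}$ (where $n,m,\Delta$ are the order, size and maximum degree of $G$).
   Context: All graphs are finite, simple and undirected. For a graph $G$ write $n=n(G)=|V(G)|$, $m=m(G)=|E(G)|$, and $\Delta=\Delta(G)$ for the maximum degree. A set $T\subseteq V(G)$ is an identifying vertex cover if $e\cap T\neq\emptyset$ for every $e\in E(G)$ and the sets $e\cap T$ ($e\in E(G)$) are pairwise distinct; $\tau_D(G)$ is the minimum cardinality of an identifying vertex cover. A packing is a set of vertices whose distinct members are at pairwise distance at least three (vertices in different components have distance $+\infty$); $\rho(G)$ is the maximum cardinality of a packing. Define $\mu(G)=\Delta(\Delta-1)n+2m-(\Delta^2+1)\tau_D(G)$. For integers $t,r\ge2$, $H_{t,r}$ is the graph on the vertex set $\{a,b\}\cup X\cup C\cup D$ (all vertices distinct), where $X=\{x_1,\dots,x_t\}$, $C=\{c_1,\dots,c_r\}$, $D=\{d_1,\dots,d_r\}$, whose edges are exactly: $ax_i$ and $bx_i$ for $1\le i\le t$; $ac_j$, $c_jd_j$ and $d_jb$ for $1\le j\le r$; and $d_id_j$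 for $1\le i<j\le r$. *)

(* Defs.v *)
From HB Require Import structures.
From mathcomp Require Import all_boot all_order all_algebra.

Set Implicit Arguments.
Unset Strict Implicit.
Unset Printing Implicit Defensive.

Import Order.TTheory GRing.Theory Num.Theory.

Record sgraph := SGraph {
  vertex :> finType;
  adj : rel vertex;
  adj_sym : symmetric adj;
  adj_irrefl : irreflexive adj }.

Arguments adj {s} _ _.

Section Graph.

Variable G : sgraph.

Definition edges : {set {set G}} :=
  [set e | [exists u : G, exists v : G, adj u v && (e == [set u; v])]].

Definition gorder : nat := #|G|.

Definition gsize : nat := #|edges|.

Definition degree (v : G) : nat := #|[set w | adj v w]|.

Definition max_degree : nat := \max_(v : G) degree v.

Definition connected : bool :=
  (0 < #|G|) && [forall u : G, forall v : G, connect adj u v].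

Definition walk (k : nat) (u v : G) : bool :=
  [exists p : k.-tuple G, path adj u p && (last u p == v)].

(* [None] stands for distance +oo.  Lengths below [#|G|] suffice, since a
   shortest walk repeats no vertex; see [dist_someP] and [dist_noneP]. *)
Definition dist (u v : G) : option nat :=
  ohead [seq k <- iota 0 #|G| | walk k u v].

Definition dist_ge (k : nat) (u v : G) : bool :=
  if dist u v is Some l then k <= l else true.

Definition packing (S : {set G}) : bool :=
  [forall u in S, forall v in S, (u != v) ==> dist_ge 3 u v].

Definition rho : nat := \max_(S : {set G} | packing S) #|S|.

Definition identifying_vertex_cover (T : {set G}) : bool :=
  [forall e in edges, e :&: T != set0] &&
  [forall e in edges, forall f in edges, (e != f) ==> (e :&: T != f :&: T)].

Definition tauD : nat :=
  #|[arg min_(T < [set: G] | identifying_vertex_cover T) #|T| ]|.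

Definition mu : int :=
  (max_degree%:Z * (max_degree%:Z - 1) * gorder%:Z + 2 * gsize%:Z
   - (max_degree%:Z ^+ 2 + 1) * tauD%:Z)%R.

Definition tauD_bound : rat :=
  ((max_degree%:R * (max_degree%:R - 1) * gorder%:R + 2 * gsize%:R)
   / (max_degree%:R ^+ 2 + 1))%R.

Lemma identifying_vertex_coverT : identifying_vertex_cover [set: G].
Proof.
apply/andP; split.
  apply/forall_inP => e; rewrite inE.
  case/existsP => u /existsP[v /andP[_ /eqP ->]]; rewrite setIT.
  by apply/set0Pn; exists u; rewrite !inE eqxx.
apply/forall_inP => e _; apply/forall_inP => f _.
by apply/implyP; rewrite !setIT.
Qed.

Lemma walkP k u v :
  reflect (exists p, [/\ size p = k, path adj u p & last u p = v])
          (walk k u v).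
Proof.
apply: (iffP existsP) => [[p /andP[Hp /eqP Hl]]|[p [Hs Hp Hl]]].
  by exists (val p); rewrite size_tuple.
have Hs' : size p == k by apply/eqP.
by exists (Tuple Hs'); rewrite /= Hp Hl eqxx.
Qed.

Lemma walk_shorten k u v : walk k u v ->
  exists2 l, l < #|G| /\ l <= k & walk l u v.
Proof.
case/walkP => p [Hs Hp Hl]; move: Hl; case/shortenP: Hp => p' Hp' Up' sub Hl.
exists (size p'); last by apply/walkP; exists p'.
split; first by move/card_uniqP: Up' => /= <-; apply: max_card.
rewrite -Hs; apply: uniq_leq_size => //.
by case/andP: Up'.
Qed.

Lemma dist_someP u v k :
  dist u v = Some k <-> walk k u v /\ (forall l, walk l u v -> k <= l).
Proof.
rewrite /dist; set s := filter _ _.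
have Ss : sorted ltn s by apply: sorted_filter (iota_ltn_sorted _ _);
  exact: ltn_trans.
have Ms l : (l \in s) = walk l u v && (l < #|G|).
  by rewrite mem_filter mem_iota.
case Es : s => [|h s'] /=.
  split=> // -[/walk_shorten[l [Hl _] Hw] _].
  by have := Ms l; rewrite Hw Hl Es.
have Hh : walk h u v && (h < #|G|) by rewrite -Ms Es mem_head.
have Hmin l : walk l u v -> h <= l.
  case/walk_shorten => l' [Hl' Hll'] Hw; apply: leq_trans Hll'.
  have : l' \in s by rewrite Ms Hw Hl'.
  rewrite Es inE => /predU1P[-> //|Hin].
  move: Ss; rewrite Es /= => Hp; apply: ltnW.
  by move: (order_path_min ltn_trans Hp) => /allP/(_ _ Hin).
case/andP: Hh => Hh _; split=> [[<-]//|[Hk Hkmin]].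
by congr Some; apply/eqP; rewrite eqn_leq Hmin // Hkmin.
Qed.

Lemma dist_noneP u v : dist u v = None <-> ~~ connect adj u v.
Proof.
case E : (dist u v) => [k|]; split=> //.
  move/dist_someP: E => [/walkP[p [_ Hp Hl]] _].
  by case/negP; apply/connectP; exists p.
move=> _; apply/negP => /connectP[p Hp Hl].
have : walk (size p) u v by apply/walkP; exists p.
case/walk_shorten => l [Hl' _] Hw.
have : l \in [seq k <- iota 0 #|G| | walk k u v].
  by rewrite mem_filter Hw mem_iota.
by move: E; rewrite /dist; case: filter.
Qed.

End Graph.

Section H.

Variables t r : nat.

Inductive Hvertex :=
  Va | Vb | Vx of 'I_t | Vc of 'I_r | Vd of 'I_r.

Definition Hvertex_encode (u : Hvertex) : bool + 'I_t + ('I_r + 'I_r) :=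
  match u with
  | Va => inl (inl true)
  | Vb => inl (inl false)
  | Vx i => inl (inr i)
  | Vc j => inr (inl j)
  | Vd j => inr (inr j)
  end.

Definition Hvertex_decode (s : bool + 'I_t + ('I_r + 'I_r)) : Hvertex :=
  match s with
  | inl (inl true) => Va
  | inl (inl false) => Vb
  | inl (inr i) => Vx i
  | inr (inl j) => Vc j
  | inr (inr j) => Vd j
  end.

Lemma Hvertex_encodeK : cancel Hvertex_encode Hvertex_decode.
Proof. by case. Qed.

HB.instance Definition _ := Finite.copy Hvertex (can_type Hvertex_encodeK).

(* Each edge is listed in exactly one orientation. *)
Definition Harc (u v : Hvertex) : bool :=
  match u, v with
  | Va, Vx _ => true
  | Vb, Vx _ => true
  | Va, Vc _ => true
  | Vc i, Vd j => i == j
  | Vd _, Vb => true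
  | Vd i, Vd j => i < j
  | _, _ => false
  end.

Definition Hadj : rel Hvertex := fun u v => Harc u v || Harc v u.

Lemma Hadj_sym : symmetric Hadj.
Proof. by move=> u v; rewrite /Hadj orbC. Qed.

Lemma Hadj_irrefl : irreflexive Hadj.
Proof. by case=> [||i|j|j]; rewrite /Hadj //= ltnn. Qed.

Definition Hgraph : sgraph := SGraph Hadj_sym Hadj_irrefl.

End H.

(* Main.v *)
(** If two distinct vertices outside an identifying vertex cover [T] were at
    distance one, their edge would be uncovered; at distance two, with common
    neighbour [w], their edges to [w] would both meet [T] in [T :&: [set w]].
    So complements of identifying vertex covers are packings, and
    [n - rho <= tauD <= n - 1].  Since [H_(t,r)] has diameter two, [rho = 1]
    and [tauD = n - 1]; everything else is counting. *)

Require Import Defs.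
From mathcomp Require Import all_boot all_order all_algebra.
From mathcomp Require Import zify ring.

Import Order.TTheory GRing.Theory Num.Theory.

(** * Edges, distances and packings in an arbitrary graph *)

Section SgraphTheory.

Variable G : sgraph.
Implicit Types (u v w : G) (S T : {set G}).

Lemma edgesP (e : {set G}) :
  reflect (exists u v, adj u v /\ e = [set u; v]) (e \in edges G).
Proof.
rewrite inE; apply: (iffP existsP) => [[u /existsP[v /andP[uv /eqP ->]]]|].
  by exists u, v.
by case=> u [v [uv ->]]; exists u; apply/existsP; exists v; rewrite uv eqxx.
Qed.

Lemma edge_in u v : adj u v -> [set u; v] \in edges G.
Proof. by move=> uv; apply/edgesP; exists u, v. Qed.

Lemma degreeE v : degree v = \sum_(w : G) adj v w.
Proof. by rewrite /degree -sum1dep_card [LHS]big_mkcond. Qed.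

(** Infinite distance needs no separate clause: [None] means that no walk exists at all, hence none
    shorter than [k]. *)
Lemma dist_geP k u v :
  reflect (forall l, l < k -> ~~ walk l u v) (dist_ge k u v).
Proof.
rewrite /dist_ge; case E: (dist u v) => [m|].
  case/dist_someP: E => mw mmin; apply: (iffP idP) => [km l lk|H].
    by apply/negP => /mmin; rewrite leqNgt (leq_trans lk km).
  by rewrite leqNgt; apply/negP => /H; rewrite mw.
constructor=> l _; apply/negP => /walkP[p [_ up pv]].
by move/dist_noneP/negP: E; apply; apply/connectP; exists p.
Qed.

Lemma dist_ge3P u v :
  reflect [/\ u != v, ~~ adj u v & forall w, adj u w -> ~~ adj w v]
          (dist_ge 3 u v).
Proof.
apply: (iffP (dist_geP 3 u v)) => [H|[uv nadj H] [|[|[|//]]] // _].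
- split.
  + by apply: contra (H 0 isT) => /eqP ->; apply/walkP; exists [::].
  + by apply: contra (H 1 isT) => uv; apply/walkP; exists [:: v]; rewrite /= uv.
  + move=> w uw; apply: contra (H 2 isT) => wv; apply/walkP.
    by exists [:: w; v]; rewrite /= uw wv.
- apply/negP => /walkP[p [/size0nil -> _ /= euv]].
  by rewrite euv eqxx in uv.
- apply/negP => /walkP[[|x [|y p]] [//= _ /andP[ux _] xv]].
  by rewrite xv (negbTE nadj) in ux.
- apply/negP => /walkP[[|x [|y [|z p]]] [//= _ /and3P[ux xy _] yv]].
  by rewrite yv (negbTE (H x ux)) in xy.
Qed.

Lemma packingP S :
  reflect {in S &, forall u v, u != v -> dist_ge 3 u v} (packing S).
Proof.
apply: (iffP forall_inP) => [H u v uS vS uv|H u uS].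
  by move/forall_inP: (H u uS) => /(_ v vS) /implyP; apply.
by apply/forall_inP => v vS; apply/implyP; apply: H.
Qed.

Lemma leq_rho S : packing S -> #|S| <= rho G.
Proof. exact: (@leq_bigmax_cond _ (@packing G) (fun S => #|S|)). Qed.

(** The vertex [u] supplies the lower bound, through the packing [[set u]]. *)
Lemma rho1 u :
  (forall v w, v != w -> ~~ dist_ge 3 v w) -> rho G = 1.
Proof.
move=> H; apply/eqP; rewrite eqn_leq; apply/andP; split.
  apply/bigmax_leqP => S /packingP Spack.
  apply/card_le1_eqP => v w vS wS; apply/eqP/idPn => vw.
  by have := H w v vw; rewrite Spack.
rewrite -(cards1 u); apply: leq_rho; apply/packingP => v w.
by rewrite !inE => /eqP -> /eqP ->; rewrite eqxx.
Qed.

(** * Identifying vertex covers and their complements *)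

Lemma identifying_vertex_coverP T :
  reflect ({in edges G, forall e, e :&: T != set0} /\
           {in edges G &, injective (fun e => e :&: T)})
          (identifying_vertex_cover T).
Proof.
apply: (iffP andP) => [[/forall_inP cov /forall_inP sep]|[cov sep]].
  split=> // e f eG fG ef; apply/eqP/idPn => nef.
  by move/forall_inP: (sep e eG) => /(_ f fG)/implyP/(_ nef); rewrite ef eqxx.
split; first exact/forall_inP.
apply/forall_inP => e eG; apply/forall_inP => f fG; apply/implyP.
by apply: contra => /eqP ef; apply/eqP; apply: sep.
Qed.

Lemma identifying_vertex_cover_packing T :
  identifying_vertex_cover T -> packing (~: T).
Proof.
case/identifying_vertex_coverP => cov sep; apply/packingP => u v.
rewrite !inE => uT vT uv; apply/dist_ge3P; split=> //.
  apply/negP => /edge_in/cov/set0Pn[x]; rewrite !inE.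
  by case/andP => /orP[] /eqP -> xT; rewrite xT in uT vT.
move=> w uw; apply/negP => wv.
(* Both edges have the same trace on [T], as [u] and [v] lie outside it. Testing the resulting
   equality at [u] forces [u = w], a loop. *)
have /setP/(_ u) : [set u; w] = [set w; v].
  apply: sep; [exact: edge_in | exact: edge_in | apply/setP => x].
  rewrite !inE; case: (eqVneq x u) => [->|_]; first by rewrite (negbTE uT) !andbF.
  by case: (eqVneq x v) => [->|_]; rewrite ?(negbTE vT) ?andbF // orbF.
rewrite !inE eqxx (negbTE uv) orbF /= => /esym/eqP euw.
by rewrite euw adj_irrefl in uw.
Qed.

(** An edge has two ends, so deleting [v] leaves at least one. The trace has one element if [v] is
    in the edge and two otherwise, so it determines the edge. *)
Lemma identifying_vertex_coverC1 v : identifying_vertex_cover (~: [set v]).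
Proof.
apply/identifying_vertex_coverP; split=> [e /edgesP[x [y [xy ->]]]|e f eG fG ef].
  have nxy : x != y by apply: contraTneq xy => ->; rewrite adj_irrefl.
  apply/set0Pn; case: (eqVneq x v) => [xv|xv]; [exists y|exists x].
    by rewrite !inE eqxx orbT -xv eq_sym nxy.
  by rewrite !inE eqxx.
have card2 g : g \in edges G -> #|g| = 2.
  case/edgesP => x [y [xy ->]]; rewrite cards2.
  by case: eqVneq xy => // ->; rewrite adj_irrefl.
have efD : e :\ v = f :\ v by rewrite !setDE.
have vef : (v \in e) = (v \in f).
  have := cardsD1 v e; have := cardsD1 v f.
  by rewrite efD (card2 e eG) (card2 f fG); case: (v \in e); case: (v \in f) => //; lia.
apply/setP => x; case: (eqVneq x v) => [-> //|xv].
by move/setP/(_ x): efD; rewrite !inE xv.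
Qed.

Lemma leq_tauD T : identifying_vertex_cover T -> tauD G <= #|T|.
Proof.
rewrite /tauD; case: arg_minnP => [|S _ Smin]; last exact: Smin.
exact: identifying_vertex_coverT.
Qed.

Lemma leq_gorder_tauD : gorder G <= rho G + tauD G.
Proof.
rewrite /tauD; case: arg_minnP => [|T Tcov _]; first exact: identifying_vertex_coverT.
rewrite /gorder -(cardsC T) addnC leq_add2r.
exact/leq_rho/identifying_vertex_cover_packing.
Qed.

Lemma tauD_lt u : tauD G < gorder G.
Proof.
apply: leq_ltn_trans (leq_tauD _ (identifying_vertex_coverC1 u)) _.
by rewrite cardsC1 /gorder prednK //; apply/card_gt0P; exists u.
Qed.

(* Choosing an orientation [a] of the graph puts edges in bijection with arcs. *)
Lemma gsize_orientation (a : rel G) :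
    (forall u v, adj u v = a u v || a v u) -> (forall u v, a u v -> ~~ a v u) ->
  gsize G = \sum_(u : G) \sum_(v : G) a u v.
Proof.
move=> adjE asym.
rewrite pair_bigA /= -big_mkcond /= sum1dep_card.
have -> : gsize G = #|[set [set p.1; p.2] | p in [set p : G * G | a p.1 p.2]]|.
  congr #|pred_of_set _|; apply/setP => e; apply/edgesP/imsetP.
    case=> u [v [uv ->]]; move: uv; rewrite adjE => /orP[uv|vu].
      by exists (u, v); rewrite ?inE.
    by exists (v, u); rewrite ?inE // setUC.
  by case=> -[u v]; rewrite inE /= => uv ->; exists u, v; rewrite adjE uv.
rewrite card_in_imset // => -[u v] [x y]; rewrite !inE /= => uv xy E.
have irr w : a w w = false by apply/negP => ww; move: (asym _ _ ww); rewrite ww.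
(* Of the four ways to place [u] and [v] in [[set x; y]], two give a loop and the swapped one
   contradicts asymmetry. *)
have := set21 u v; rewrite E !inE => /orP[] /eqP Eu.
  have := set22 u v; rewrite E !inE => /orP[] /eqP Ev; last by rewrite Eu Ev.
  by rewrite Eu Ev irr in uv.
have := set22 u v; rewrite E !inE => /orP[] /eqP Ev; last by rewrite Eu Ev irr in uv.
by rewrite Eu Ev (negbTE (asym _ _ xy)) in uv.
Qed.

(** Multiplying by the positive denominator leaves a difference that is exactly [mu G], cast to
    [rat]. *)
Lemma leq_tauD_bound :
  ((tauD G)%:R <= tauD_bound G :> rat)%R = (0 <= mu G)%R.
Proof.
have pos : (0 < (max_degree G)%:R ^+ 2 + 1 :> rat)%R.
  by rewrite ltr_wpDl // exprn_ge0 // ler0n.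
rewrite /tauD_bound ler_pdivlMr // -(ler0z rat) -[LHS]subr_ge0; congr (0 <= _)%R.
by rewrite /mu !rmorphE /= !pmulrn; ring.
Qed.

End SgraphTheory.

(** * Order, size and degrees of [Hgraph t r] *)

Section HgraphTheory.

Variables t r : nat.
Local Notation H := (Hgraph t r).
Implicit Types u v : H.

Lemma sum_Hvertex (F : Hvertex t r -> nat) :
  \sum_u F u = F (Va t r) + F (Vb t r) + \sum_i F (Vx r i)
               + \sum_j F (Vc t j) + \sum_j F (Vd t j).
Proof.
rewrite (reindex_onto (@Hvertex_decode t r) (@Hvertex_encode t r)) /=; last first.
  by move=> u _; apply: Hvertex_encodeK.
rewrite (eq_bigl predT); last by case=> [[[]|]|[]] * /=; apply: eqxx.
by rewrite !big_sumType /= big_bool !addnA.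
Qed.

Lemma sum_ord_ltn n (j : 'I_n) : \sum_(i < n) (i < j) = j.
Proof.
rewrite -big_mkcond /= (big_ord_narrow (ltnW (ltn_ord j))).
by rewrite sum1_card card_ord.
Qed.

Lemma sum_eq1 (T : finType) (x : T) : \sum_y (x == y) = 1.
Proof.
by rewrite -big_mkcond /= (eq_bigl (pred1 x)) ?big_pred1_eq // => y; rewrite eq_sym.
Qed.

(** By trichotomy, the indices below, above and equal to [i] total [n]. *)
Lemma sum_ord_gtn n (i : 'I_n) : \sum_(j < n) (i < j) = n - i.+1.
Proof.
have : \sum_(j < n) ((i < j) + (j < i) + (i == j)) = n.
  rewrite -[RHS]card_ord -sum1_card; apply: eq_bigr => j _.
  by rewrite -val_eqE /=; case: ltngtP.
by rewrite !big_split /= sum_ord_ltn sum_eq1; lia.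
Qed.

Lemma Hgraph_gorder : gorder H = t + 2 * r + 2.
Proof.
rewrite /gorder -sum1_card sum_Hvertex !sum1_card !card_ord; lia.
Qed.

Lemma Hgraph_gsize : gsize H = 2 * t + 3 * r + 'C(r, 2).
Proof.
rewrite (@gsize_orientation H (@Harc t r)) //; last first.
  by case=> [||i|j|j] [||i'|j'|j'] //=; rewrite -leqNgt => /ltnW.
(* Edges of the clique on D, counted by larger endpoint. *)
have sumd : \sum_(i < r) \sum_(j < r) (i < j) = 'C(r, 2).
  by rewrite exchange_big -bin2_sum big_mkord; apply: eq_bigr => j _; apply: sum_ord_ltn.
have sumx i : \sum_(v : Hvertex t r) Harc (Vx r i : Hvertex t r) v = 0 by rewrite /= sum_nat_const muln0.
have sumc j : \sum_(v : Hvertex t r) Harc (Vc t j) v = 1.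
  by rewrite sum_Hvertex /= sum_eq1 !sum_nat_const; lia.
have sumdv i : \sum_(v : Hvertex t r) Harc (Vd t i) v = 1 + \sum_(j < r) (i < j).
  by rewrite sum_Hvertex /= !sum_nat_const; lia.
(* Out-degrees under [Harc]: [t + r] at [Va], [t] at [Vb], 0 on X, 1 on C, and on D one arc to [Vb]
   plus the clique arcs. *)
rewrite sum_Hvertex (eq_bigr _ (fun i _ => sumx i)) (eq_bigr _ (fun j _ => sumc j)).
rewrite (eq_bigr _ (fun i _ => sumdv i)) big_split /= sumd !sum_Hvertex /=.
by rewrite !sum_nat_const !card_ord; lia.
Qed.

Lemma Hgraph_degree u :
  degree u = match u with
             | Va | Vb => t + r
             | Vx _ | Vc _ => 2
             | Vd _ => r.+1
             end.
Proof.
rewrite degreeE [LHS]sum_Hvertex /Hgraph /= /Hadj.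
case: u => [||i|j|j] /=; rewrite ?sum_nat_const ?card_ord; try lia.
  under eq_bigr do rewrite orbF.
  by rewrite sum_eq1; lia.
under [X in _ + X + _]eq_bigr do rewrite eq_sym.
rewrite sum_eq1.
(* The two alternatives exclude each other, so the disjunction is a sum; it counts the [r - 1]
   clique neighbours. *)
have -> : \sum_(k < r) ((j < k) || (k < j)) = \sum_(k < r) (j < k) + \sum_(k < r) (k < j).
  by rewrite -big_split /=; apply: eq_bigr => k _; case: ltngtP.
rewrite sum_ord_ltn sum_ord_gtn; have := ltn_ord j; lia.
Qed.

(** * Maximum degree, diameter two and the resulting invariants *)

Hypotheses (t_ge2 : 2 <= t) (r_gt0 : 0 < r).

Lemma Hgraph_max_degree : max_degree H = t + r.
Proof.
apply/eqP; rewrite eqn_leq; apply/andP; split.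
  by apply/bigmax_leqP => u _; rewrite Hgraph_degree; case: u => *; lia.
have := @leq_bigmax _ (@degree H) (Va t r); rewrite Hgraph_degree.
exact.
Qed.

(** Middle vertices: some x for a and b; [c_j] for a and [d_j]; [d_j] for b and [c_j]; a within X
    and C together; b between X and D; [d_i] for [c_i] and [d_j] with distinct indices. The
    alternatives may overlap. *)
Lemma Hgraph_diameter2 u v :
  [\/ u = v, adj u v | exists2 w, adj u w & adj w v].
Proof.
pose x0 : 'I_t := Ordinal (ltnW t_ge2).
rewrite /adj /= /Hadj; case: u v => [||i|j|j] [||i'|j'|j'] /=;
  try (by apply: Or31); try (by apply: Or32).
- by apply: Or33; exists (Vx r x0).
- by apply: Or33; exists (Vc t j') => /=; rewrite ?eqxx.
- by apply: Or33; exists (Vx r x0).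
- by apply: Or33; exists (Vd t j') => /=; rewrite ?eqxx.
- by apply: Or33; exists (Va t r).
- by apply: Or33; exists (Va t r).
- by apply: Or33; exists (Vb t r).
- by apply: Or33; exists (Vd t j) => /=; rewrite ?eqxx.
- by apply: Or33; exists (Va t r).
- by apply: Or33; exists (Va t r).
- case: (eqVneq j j') => [->|jj']; first by apply: Or32; rewrite ?eqxx.
  by apply: Or33; exists (Vd t j) => /=; rewrite ?eqxx -?neq_ltn.
- by apply: Or33; exists (Vc t j) => /=; rewrite ?eqxx.
- by apply: Or33; exists (Vb t r).
- case: (eqVneq j j') => [->|jj']; first by apply: Or32; rewrite ?eqxx.
  by apply: Or33; exists (Vd t j') => /=; rewrite ?eqxx -?neq_ltn.
- case: (eqVneq j j') => [->|jj']; first exact: Or31.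
  by apply: Or32; rewrite -neq_ltn.
Qed.

Lemma Hgraph_connected : connected H.
Proof.
apply/andP; split; first by apply/card_gt0P; exists (Va t r).
apply/forallP => u; apply/forallP => v.
case: (Hgraph_diameter2 u v) => [->|uv|[w uw wv]]; first exact: connect0.
  exact: connect1.
exact: connect_trans (connect1 uw) (connect1 wv).
Qed.

Lemma Hgraph_rho : rho H = 1.
Proof.
apply: (@rho1 H (Va t r)) => u v uv; apply/negP => /dist_ge3P[_ nuv nw].
case: (Hgraph_diameter2 u v) => [euv|auv|[w uw wv]].
- by rewrite euv eqxx in uv.
- by rewrite auv in nuv.
- by have := nw w uw; rewrite wv.
Qed.

Lemma Hgraph_tauD : tauD H = t + 2 * r + 1.
Proof.
have := leq_gorder_tauD H; have := tauD_lt H (Va t r).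
by rewrite Hgraph_rho Hgraph_gorder; lia.
Qed.

(** Since [tauD] is n - 1, [mu] collapses to 2m + Δ^2 + 1 - (Δ + 1)n, where the squares of t and r
    cancel. *)
Lemma Hgraph_mu : mu H = (- ((t%:Z - 1) * (r%:Z - 1)))%R.
Proof.
rewrite /mu Hgraph_max_degree Hgraph_gorder Hgraph_gsize Hgraph_tauD.
(* The binomial enters through 2m, so its double is turned into a polynomial for [nia]. *)
have : 'C(r, 2) * 2 = r * r.-1 by rewrite -[2]/(2`!) bin_ffact ffactnS ffactn1.
nia.
Qed.

End HgraphTheory.

Theorem theorem3p1 (t r : nat) (ht : (2 <= t)%N) (hr : (2 <= r)%N) :
  connected (Hgraph t r) /\
  gorder (Hgraph t r) = (t + 2 * r + 2)%N /\
  gsize (Hgraph t r) = (2 * t + 3 * r + 'C(r, 2))%N /\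
  max_degree (Hgraph t r) = (t + r)%N /\
  rho (Hgraph t r) = 1%N /\
  tauD (Hgraph t r) = (t + 2 * r + 1)%N /\
  mu (Hgraph t r) = (- ((t%:Z - 1) * (r%:Z - 1)))%R /\
  (mu (Hgraph t r) < 0)%R /\
  ~ ((tauD (Hgraph t r))%:R <= tauD_bound (Hgraph t r))%R.
Proof.
have r_gt0 := ltnW hr.
(* Strict because both factors t - 1 and r - 1 are at least 1. *)
have mu_lt0 : (mu (Hgraph t r) < 0)%R by rewrite Hgraph_mu //; nia.
rewrite leq_tauD_bound leNgt mu_lt0.
by rewrite Hgraph_connected // Hgraph_gorder Hgraph_gsize Hgraph_max_degree //
  Hgraph_rho // Hgraph_tauD // Hgraph_mu.
Qed.
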